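(* There exists an absolute constant $C>0$ such that for every integer $k\ge 1$ and every finite undirected unweighted graph $G$ whose vertex set can be covered by at most $k$ shortest paths (i.e., there are shortest paths $P_1,\dots,P_m$ of $G$, $m\le k$, with $V(G)=\bigcup_i V(P_i)$), the pathwidth of $G$ satisfies $\operatorname{pw}(G)\le C\cdot k\cdot 3^k$.
   Context: A path decomposition of $G=(V,E)$ is a sequence $(X_1,\dots,X_q)$ of subsets of $V$ such that every edge has both endpoints in some $X_i$, and for every vertex $x$ the indices $i$ with $x\in X_i$ form a contiguous interval. Its width is $\max_i |X_i|-1$, and $\operatorname{pw}(G)$ is the minimum width of a path decomposition of $G$. A shortest path is a path between two vertices whose number of edges equals their distance in $G$. *)

(* Defs.v *)
From mathcomp Require Import all_boot all_order all_algebra.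
From mathcomp Require Import boolp reals.

Set Implicit Arguments.
Unset Strict Implicit.
Unset Printing Implicit Defensive.

Import Order.TTheory GRing.Theory Num.Theory.

Definition simple_graph (T : finType) (e : rel T) : Prop :=
  symmetric e /\ irreflexive e.

(* Paths are given by their full vertex sequence, hence are nonempty, and
   have (size s).-1 edges. *)
Definition path_between (T : finType) (e : rel T) (x y : T) (s : seq T) : Prop :=
  exists2 p, s = x :: p & [/\ path e x p, last x p = y & uniq (x :: p)].

Definition path_of_length (T : finType) (e : rel T) (x y : T) : pred nat :=
  fun n => `[< exists2 s, path_between e x y s & (size s).-1 = n >].

(* None is the infinite distance between vertices of distinct components. *)
Definition dist (T : finType) (e : rel T) (x y : T) : option nat :=
  if pselect (exists n, path_of_length e x y n) is left ex
  then Some (ex_minn ex) else None.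

Definition shortest_path (T : finType) (e : rel T) (s : seq T) : Prop :=
  exists x y, path_between e x y s /\ dist e x y = Some (size s).-1.

Definition covered_by_shortest_paths (T : finType) (e : rel T) (k : nat) : Prop :=
  exists P : seq (seq T),
    [/\ (size P <= k)%N,
        forall s, s \in P -> shortest_path e s &
        forall x, exists2 s, s \in P & x \in s].

(* The indices of the bags containing a given vertex form an interval, which
   has to be nonempty: isolated vertices also belong to some bag. *)
Definition path_decomposition (T : finType) (e : rel T) (X : seq {set T}) : Prop :=
  [/\ forall x y, e x y -> exists2 B, B \in X & (x \in B) && (y \in B),
      forall x, exists2 B, B \in X & x \in B &
      forall x i j l, (i <= j <= l)%N -> (l < size X)%N ->
        x \in nth set0 X i -> x \in nth set0 X l -> x \in nth set0 X j].

(* Integer-valued: the graph without vertices has a decomposition of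
   width -1. *)
Definition width (T : finType) (X : seq {set T}) : int :=
  ((\max_(B <- X) #|B|)%N%:Z - 1)%R.

Definition has_width_pred (T : finType) (e : rel T) : pred nat :=
  fun n => `[< exists2 X, path_decomposition e X & width X = (n%:Z - 1)%R >].

Lemma ex_has_width_pred (T : finType) (e : rel T) :
  exists n, has_width_pred e n.
Proof.
exists (\max_(B <- [:: [set: T]]) #|B|)%N; apply/asboolP.
exists [:: [set: T]] => //; split=> [x y _|x|x i j l /andP[_ jl] l0 _ _].
- by exists [set: T]; rewrite ?inE.
- by exists [set: T]; rewrite ?inE.
- by case: l jl l0 => //; case: j => //= _ _; rewrite inE.
Qed.

Definition pathwidth (T : finType) (e : rel T) : int :=
  ((ex_minn (ex_has_width_pred e))%:Z - 1)%R.

Lemma pathwidth_attained (T : finType) (e : rel T) :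
  exists2 X, path_decomposition e X & width X = pathwidth e.
Proof. by rewrite /pathwidth; case: ex_minnP => n /asboolP. Qed.

Lemma pathwidth_le (T : finType) (e : rel T) (X : seq {set T}) :
  path_decomposition e X -> (pathwidth e <= width X)%R.
Proof.
move=> dX; rewrite /pathwidth; case: ex_minnP => n _ nmin.
rewrite /width lerD2r lez_nat; apply: nmin.
by apply/asboolP; exists X.
Qed.

(* Main.v *)
(* Colour every vertex by one of the k covering geodesics containing it.  Given a
   vertex a and a set S of colours, each with a direction, walk greedily from a:
   follow the current geodesic in its direction until the first vertex adjacent
   to an unused colour of S, switch to that colour, and so on.  A shortest path
   from a to v can be rerouted into such a greedy walk: at the first possible
   exit, to colour c say, jump to c and follow its geodesic up to the last vertex
   of colour c of the path.  This lengthens the walk by at most 2 and forgets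
   the colours used in between, without changing the earlier greedy choices.  So
   a vertex at distance D from a is determined by one of the 3 ^ k choices
   (unused, forwards, backwards for each colour) and by a length between D and
   D + 2k, and D-spheres have at most (2k + 1) * 3 ^ k vertices.  Unions of two
   consecutive spheres form a path decomposition. *)
Require Import Defs.
From mathcomp Require Import all_boot all_order all_algebra.
From mathcomp Require Import boolp reals.
From mathcomp Require Import zify.

Set Implicit Arguments.
Unset Strict Implicit.
Unset Printing Implicit Defensive.

Import Order.TTheory GRing.Theory Num.Theory.

(** * Walks, and geodesics as vertex sequences *)

Section Walks.
Variables (T : finType) (e : rel T).
Hypothesis e_sym : symmetric e.

Definition walk (x y : T) (n : nat) : Prop :=
  exists p, [/\ path e x p, last x p = y & size p = n].

Lemma walk0 x : walk x x 0.
Proof. by exists [::]. Qed.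

Lemma walk1 x y : e x y -> walk x y 1.
Proof. by move=> exy; exists [:: y]; rewrite /= exy. Qed.

Lemma walk_trans y x z m n : walk x y m -> walk y z n -> walk x z (m + n).
Proof.
move=> [p [ep lp <-]] [q [eq lq <-]]; exists (p ++ q).
by rewrite cat_path ep lp eq last_cat lp lq size_cat.
Qed.

Lemma walk_sym x y n : walk x y n -> walk y x n.
Proof.
move=> [p [ep lp sp]]; exists (rev (belast x p)); split.
- by rewrite -lp rev_path; under eq_path do rewrite e_sym.
- by case: p {ep sp} lp => [|z p] //=; rewrite rev_cons last_rcons.
- by rewrite size_rev size_belast.
Qed.

Lemma walk_nth x0 s i j : sorted e s -> i <= j < size s ->
  walk (nth x0 s i) (nth x0 s j) (j - i).
Proof.
move=> es /andP[ij js].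
elim: j ij js => [|j IH].
  by rewrite leqn0 => /eqP-> _; rewrite subnn; apply: walk0.
rewrite leq_eqVlt => /orP[/eqP-> _|]; first by rewrite subnn; apply: walk0.
rewrite ltnS => ij js; rewrite subSn // -[(j - i).+1]addn1.
apply: (walk_trans (IH ij (ltnW js))); apply: walk1.
by move/(sortedP x0): es; apply.
Qed.

(** The empty sequence qualifies, so a cover by fewer than [k] paths can be padded to a family
    indexed by ['I_k]. *)
Definition geodesic (s : seq T) : Prop :=
  sorted e s /\ forall x0 i j n, i <= j < size s ->
    walk (nth x0 s i) (nth x0 s j) n -> j - i <= n.

Lemma geodesic_nil : geodesic [::].
Proof. by split=> // x0 i j n; rewrite ltn0 andbF. Qed.

(** A shortcut between two entries could be spliced into [s]. Since [dist] counts only simple paths,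
    the resulting walk is first shortened to one. *)
Lemma shortest_path_geodesic s : shortest_path e s -> geodesic s.
Proof.
move=> [x [y [[p -> [ep lp up]] dxy]]]; split=> // x0 i j n /andP[ij js] w.
have [q [eq lq sq]] : walk x y (i + n + ((size p) - j)).
  rewrite /= ltnS in js.
  apply: (walk_trans _ (y := nth x0 (x :: p) j)).
    apply: (walk_trans _ w).
    by have := @walk_nth x0 (x :: p) 0 i ep; rewrite subn0; apply; rewrite /=; lia.
  have := @walk_nth x0 (x :: p) j (size p) ep.
  by rewrite [nth _ _ (size p)]nth_last /= lp; apply; rewrite js /=.
move: dxy; rewrite /dist; case: pselect => // ex [].
case: ex_minnP => m _ mmin mE.
case/shortenP: eq lq sq => q' eq' uq' sub lq sq.
have : m <= size q'.
  by apply: mmin; apply/asboolP; exists (x :: q') => //; exists q'.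
have : size q' <= size q.
  by apply: uniq_leq_size sub; case/andP: uq'.
move: ij js; rewrite mE /=; lia.
Qed.

End Walks.

Lemma split_last_has (T : Type) (P : pred T) (s : seq T) : has P s ->
  exists s1 z s2, [/\ s = s1 ++ z :: s2, P z & ~~ has P s2].
Proof.
elim: s => //= x s IH; case: (boolP (has P s)) => [/IH|nPs].
  by move=> [s1 [z [s2 [-> Pz ns2]]]] _; exists (x :: s1), z, s2.
by rewrite orbF => Px; exists [::], x, s.
Qed.

(** * Greedy walks and rerouting *)

Section Reach.
Variables (T : finType) (e : rel T) (k : nat).
Variables (P : 'I_k -> seq T) (col : T -> 'I_k) (x0 : T).
Hypothesis e_sym : symmetric e.
Hypothesis geoP : forall c, geodesic e (P c).
Hypothesis colP : forall x, x \in P (col x).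

Definition exit_to (A : {set 'I_k}) (y x : T) := e y x && (col x \in A).

Definition first_exit (A : {set 'I_k}) (r : seq T) : nat :=
  find (fun y => [exists x, exit_to A y x]) r.

Definition forward_ray (x : T) := drop (index x (P (col x))) (P (col x)).
Definition backward_ray (x : T) :=
  rev (take (index x (P (col x))).+1 (P (col x))).

(* The candidates for the vertices at the end of a walk of length [l] that starts
   along [r] and then uses only colours of [A]; [n] is fuel, at least [#|A|].
   When [l] is too small, [l - i.+1] truncates and [nth] defaults to [x0]: this
   only adds useless candidates. *)
Fixpoint reach (n : nat) (A : {set 'I_k}) (r : seq T) (l : nat) : seq T :=
  if n isn't m.+1 then [:: nth x0 r l] else
  let i := first_exit A r in
  if [pick x | exit_to A (nth x0 r i) x] is Some x then
    let B := A :\ col x in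
    reach m B r l ++ reach m B (forward_ray x) (l - i.+1)
                  ++ reach m B (backward_ray x) (l - i.+1)
  else [:: nth x0 r l].

Lemma size_reach n A r l : size (reach n A r l) <= 3 ^ n.
Proof.
elim: n A r l => [|n IH] A r l //=.
case: pickP => [x _|_]; last by rewrite expn_gt0.
rewrite !size_cat expnS.
set B := A :\ col x; set i := (first_exit A r).+1.
have := IH B r l; have := IH B (forward_ray x) (l - i).
have := IH B (backward_ray x) (l - i).
move=> h1 h2 h3; rewrite mulSn mulSn mul1n; exact: leq_add h3 (leq_add h2 h1).
Qed.

(** Both [x] and [z] lie on the geodesic of their common colour; their order on it selects the ray,
    and geodesicity bounds the position of [z] on that ray. *)
Lemma ray_through x z n : col z = col x -> walk e x z n ->
  exists r i, [/\ r = forward_ray x \/ r = backward_ray x, sorted e r,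
    i < size r, nth x0 r 0 = x & nth x0 r i = z /\ i <= n].
Proof.
move=> cz wxz; have xs := colP x; have := colP z; rewrite cz => zs.
have [ss gs] := geoP (col x).
rewrite /forward_ray /backward_ray; set s := P (col x) in xs zs ss gs *.
have := nth_index x0 xs; have := nth_index x0 zs.
move: (xs) (zs); rewrite -!index_mem.
move: (index x s) (index z s) => p q ps qs zE xE.
case: (leqP p q) => pq.
  exists (drop p s), (q - p); split; [by left| exact: drop_sorted | | |].
  - by rewrite size_drop ltn_sub2rE.
  - by rewrite nth_drop addn0.
  - rewrite nth_drop subnKC //; split=> //.
    by apply: (gs x0); rewrite ?pq //= xE zE.
exists (rev (take p.+1 s)), (p - q).
have st : size (take p.+1 s) = p.+1 by apply: size_takel.
split; [by right| | | |].
- rewrite rev_sorted; apply: take_sorted.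
  by under eq_sorted do rewrite e_sym.
- by rewrite size_rev st ltnS leq_subr.
- by rewrite nth_rev st // subn1 nth_take.
- rewrite nth_rev st; last by lia.
  rewrite subSS subKn ?nth_take; try lia.
  split=> //; apply: (gs x0); first by rewrite (ltnW pq).
  by rewrite xE zE; apply: walk_sym.
Qed.

(* Rerouting through the first exit costs at most 2: the exit edge, and at most
   one more than the detour it replaces. *)
Lemma reach_walk n (A : {set 'I_k}) r i q : #|A| <= n -> sorted e r -> i < size r ->
  path e (nth x0 r i) q -> all (fun x => col x \in A) q ->
  exists l, [/\ l <= i + size q + n.*2,
    last (nth x0 r i) q \in reach n A r l &
    walk e (nth x0 r 0) (last (nth x0 r i) q) l].
Proof.
elim: n A r i q => [|n IH] A r i q cA sr ir eq Aq.
  have A0 : A = set0 by apply: cards0_eq; apply/eqP; rewrite -leqn0.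
  case: q eq Aq => [|y q] /=; last by rewrite A0 inE.
  move=> _ _; exists i; rewrite mem_seq1 eqxx; split=> //; first by lia.
  by have := @walk_nth _ e x0 r 0 i sr; rewrite subn0; apply; rewrite ir.
have exits y q' : q = y :: q' -> has (fun y => [exists x, exit_to A y x]) r
    /\ first_exit A r <= i.
  move=> qE; move: eq Aq; rewrite qE /= => /andP[ey _] /andP[Ay _].
  have ex : [exists x, exit_to A (nth x0 r i) x].
    by apply/existsP; exists y; rewrite /exit_to ey Ay.
  split; first by apply/(has_nthP x0); exists i.
  rewrite leqNgt; apply/negP => lt.
  by have := before_find x0 lt; rewrite ex.
rewrite /=; case: pickP => [x|none]; last first.
  case: q eq Aq exits => [|y q] eq Aq exits.
    exists i; rewrite /= mem_seq1 eqxx; split=> //; first by lia.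
    by have := @walk_nth _ e x0 r 0 i sr; rewrite subn0; apply; rewrite ir.
  have [/(nth_find x0)/existsP[x]] := exits _ _ erefl.
  by rewrite -/(first_exit A r) none.
set f := first_exit A r in exits *; set c := col x => /andP[efx Ac].
have cB : #|A :\ c| <= n by move: cA; rewrite (cardsD1 c) Ac add1n ltnS.
(* If [q] avoids [c], the colour is dropped and [r] is kept. This covers empty [q], where [f] need
   not be a genuine exit. *)
case: (boolP (has (fun y => col y == c) q)) => [|/hasPn nc]; last first.
  have [l [li vl wl]] : exists l, [/\ l <= i + size q + n.*2,
    last (nth x0 r i) q \in reach n (A :\ c) r l &
    walk e (nth x0 r 0) (last (nth x0 r i) q) l].
    apply: IH => //; apply/allP => y yq; rewrite !inE nc //=.
    exact: (allP Aq).
  by exists l; rewrite mem_cat vl; split=> //; lia.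
move=> /split_last_has[q1 [z [q2 [qE /eqP cz nq2]]]].
have fi : f <= i.
  by move: exits; rewrite qE; case: (q1) => [|y q'] /(_ _ _ erefl)[].
have wf : walk e (nth x0 r 0) (nth x0 r f) f.
  by have := @walk_nth _ e x0 r 0 f sr; rewrite subn0; apply; rewrite /=; lia.
have wfi : walk e (nth x0 r f) (nth x0 r i) (i - f) by apply: walk_nth; rewrite ?fi.
move: eq Aq; rewrite qE cat_path all_cat /= => /and3P[eq1 ez eq2] /and3P[_ _ Aq2].
(* Back from [x] to the exit, along [r] to position [i], then along [q] to [z]: this bounds the
   position [j] of [z] on the new ray. *)
have wxz : walk e x z (1 + (i - f) + (size q1 + 1)).
  apply: (walk_trans (y := nth x0 r i)).
    by apply: (walk_trans (y := nth x0 r f)) => //; apply: walk_sym => //; apply: walk1.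
  by apply: (walk_trans (y := last (nth x0 r i) q1)); [exists q1 | apply: walk1].
have [r' [j [r'E sr' jr' r'0 [zE jn]]]] := ray_through cz wxz.
rewrite last_cat /=.
have [||l [ll vl wl]] := IH (A :\ c) r' j q2 cB sr' jr'.
- by rewrite zE.
- apply/allP => y yq; rewrite !inE (allP Aq2 _ yq) andbT.
  by apply: contra nq2 => cy; apply/hasP; exists y.
(* With [j <= i - f + size q1 + 2], the total exceeds [i + size q] by at most [2 + n.*2], the
   allowance for [n.+1] colours. *)
exists (f + 1 + l); split.
- by rewrite size_cat /=; move: ll; lia.
- rewrite zE in vl; rewrite !mem_cat (_ : f + 1 + l - f.+1 = l); last by lia.
  by case: r'E => <-; rewrite vl ?orbT.
- rewrite zE r'0 in wl; apply: (walk_trans _ wl).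
  by apply: (walk_trans wf); apply: walk1.
Qed.

End Reach.

(** * Sphere sizes and pathwidth *)

Lemma card_sphere (T : finType) (e : rel T) (k : nat) (a : T) (D : nat)
    (S : {set T}) : symmetric e -> covered_by_shortest_paths e k ->
  (forall v, v \in S -> walk e a v D /\ forall n, walk e a v n -> D <= n) ->
  #|S| <= (k.*2.+1) * 3 ^ k.
Proof.
move=> e_sym [P [sP shP covP]] dS.
have [col colP] : {col : T -> 'I_k & forall x, x \in nth [::] P (col x)}.
  apply: (choice (P := fun x (c : 'I_k) => x \in nth [::] P c)) => x.
  have [s sinP xs] := covP x.
  have lt : index s P < k by apply: leq_trans sP; rewrite index_mem.
  by exists (Ordinal lt); rewrite /= nth_index.
have geoP (c : 'I_k) : geodesic e (nth [::] P c).
  have [lt|ge] := ltnP c (size P); last by rewrite nth_default //; apply: geodesic_nil.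
  by apply: shortest_path_geodesic; apply: shP; apply: mem_nth.
(* The initial ray is [a] alone, with every colour still available; the candidates do not depend on
   [v]. *)
pose rc := reach e (fun c : 'I_k => nth [::] P c) col a k setT [:: a].
pose F := flatten [seq rc l | l <- iota D k.*2.+1].
have sF : size F <= k.*2.+1 * 3 ^ k.
  rewrite /F -[X in _ <= X * _](size_iota D); elim: (iota _ _) => //= l ls IH.
  by rewrite size_cat mulSn leq_add // size_reach.
apply: leq_trans sF; apply: leq_trans (card_size F).
apply: subset_leq_card; apply/subsetP => v /dS[[q [eq lq sq]] minD].
have [||l [ll vl wl]] :=
  reach_walk (x0 := a) e_sym geoP colP (n := k) (A := setT) (r := [:: a])
    (i := 0) _ isT isT eq _.
- by rewrite cardsT card_ord.
- by apply/allP => ? _; rewrite inE.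
rewrite /= lq in vl wl; apply/flatten_mapP; exists l => //.
rewrite mem_iota (minD _ wl) /=; move: ll; rewrite sq; lia.
Qed.

Lemma pathwidth_layering (T : finType) (e : rel T) (h : T -> nat) (b : nat) :
  symmetric e -> (forall x y, e x y -> h y <= (h x).+1) ->
  (forall j, #|[set x | h x == j]| <= b) ->
  (pathwidth e <= (b.*2)%:Z - 1)%R.
Proof.
move=> e_sym hE hb.
pose m := (\max_x h x).+1.
(* A vertex [x] lies only in the bags of index [h x] and, if [h x] is positive, [(h x).-1], whence
   contiguity. *)
pose bag j := [set x | h x == j] :|: [set x | h x == j.+1].
have hm x : h x < m by rewrite ltnS leq_bigmax.
have dX : path_decomposition e (mkseq bag m).
  have inX x j : h x = j \/ h x = j.+1 -> j < m ->
      exists2 B, B \in mkseq bag m & x \in B.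
    move=> hx jm; exists (bag j); first by apply: map_f; rewrite mem_iota.
    by rewrite !inE; case: hx => ->; rewrite eqxx ?orbT.
  split=> [x y exy|x|x i j l /andP[ij jl]].
  - wlog hxy : x y exy / h x <= h y.
      move=> W; case: (leqP (h x) (h y)) => [|/ltnW] hxy; first exact: W.
      have [|B BX /andP[yB xB]] := W y x _ hxy; first by rewrite e_sym.
      by exists B; rewrite ?xB.
    exists (bag (h x)); first by apply: map_f; rewrite mem_iota /=.
    by rewrite !inE eqxx /=; have := hE _ _ exy; lia.
  - by apply: (inX x (h x)) => //; left.
  - rewrite size_mkseq => lm; rewrite !nth_mkseq ?inE; lia.
apply: le_trans (pathwidth_le dX) _; rewrite /width lerD2r lez_nat.
rewrite -addnn; apply/bigmax_leqP_seq => _ /mapP[j _ ->] _.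
by apply: leq_trans (leq_card_setU _ _) (leq_add (hb _) (hb _)).
Qed.

Lemma pathwidth_spheres (T : finType) (e : rel T) (b : nat) : symmetric e ->
  (forall a D (S : {set T}),
    (forall v, v \in S -> walk e a v D /\ forall n, walk e a v n -> D <= n) ->
    #|S| <= b) ->
  (pathwidth e <= (b.*2)%:Z - 1)%R.
Proof.
move=> e_sym hb.
have csym : connect_sym e by apply: sym_connect_sym.
have [d dP] : {d : T -> nat & forall x, walk e (fingraph.root e x) x (d x) /\
    forall n, walk e (fingraph.root e x) x n -> d x <= n}.
  apply: (choice (P := fun x n => walk e (fingraph.root e x) x n /\
    forall m, walk e (fingraph.root e x) x m -> n <= m)) => x.
  have ex : exists n, `[< walk e (fingraph.root e x) x n >].
    have : connect e (fingraph.root e x) x by rewrite csym connect_root.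
    by case/connectP=> p ep lp; exists (size p); apply/asboolP; exists p.
  case: (ex_minnP ex) => n /asboolP wn minn; exists n; split=> // m wm.
  by apply: minn; apply/asboolP.
pose N := (\max_x d x).+1.
have dN x : d x < N by rewrite ltnS leq_bigmax.
(* Each component gets its own block of [N] values, so a layer of [h] never mixes components and
   lies in a single sphere around a root. *)
pose h x := enum_rank (fingraph.root e x) * N + d x.
have hinj x y : h x = h y -> fingraph.root e x = fingraph.root e y /\ d x = d y.
  move=> E; have := congr1 (divn^~ N) E; have := congr1 (modn^~ N) E.
  rewrite /h !modnMDl !modn_small // !divnMDl // !divn_small // !addn0 => -> E'.
  by split=> //; apply: enum_rank_inj; apply: val_inj.
apply: (@pathwidth_layering _ _ h) => // [x y exy|j].
  have rxy : fingraph.root e y = fingraph.root e x.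
    by apply/esym/(fingraph.rootP csym); apply: connect1.
  rewrite /h rxy -addnS leq_add2l; apply: (dP y).2; rewrite rxy -addn1.
  exact: walk_trans (dP x).1 (walk1 exy).
case: (set_0Vmem [set x | h x == j]) => [->|[x]]; first by rewrite cards0.
rewrite inE => /eqP hx.
apply: (hb (fingraph.root e x) (d x)) => v; rewrite inE => /eqP hv.
have [<- <-] : fingraph.root e v = fingraph.root e x /\ d v = d x.
  by apply: hinj; rewrite hx.
exact: dP.
Qed.

Theorem theorem2 (R : realType) :
  exists C : R, (0 < C)%R /\
    forall k : nat, (1 <= k)%N ->
    forall (T : finType) (e : rel T), simple_graph e ->
      covered_by_shortest_paths e k ->
      ((pathwidth e)%:~R <= C * k%:R * 3%:R ^+ k)%R.
Proof.
(* Two spheres contribute [2 * (2 * k + 1) <= 6 * k] times [3 ^ k], as [k >= 1]. *)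
exists 6%:R%R; split=> [|k k1 T e [e_sym _] cov]; first by rewrite ltr0n.
have := pathwidth_spheres e_sym (fun a D S => @card_sphere T e k a D S e_sym cov).
move=> pw; rewrite -natrX -!natrM -[leRHS]/((_ : nat)%:Z%:~R)%R ler_int.
apply: le_trans pw _.
have := expn_gt0 3 k; move: (3 ^ k) => t; rewrite /= => t0; nia.
Qed.
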